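(* (Goddard uniqueness) Let $(V,Y,e^{\mathbf z\cdot\mathbf T},|0\rangle)$ be an $(n,N)$-cohomological vertex algebra over a commutative ring $R$. Let $A(\mathbf z)$ be a homogeneous cohomological field on $V$ that is mutually local with $Y(b,\mathbf w)$ for all $b\in V$. If there exists a homogeneous $a\in V$ such that $A(\mathbf z)|0\rangle=Y(a,\mathbf z)|0\rangle$, then $A(\mathbf z)=Y(a,\mathbf z)$.
   Context: Fix a commutative ring $R$ and integers $N,n$ with $n\ge1$; $\mathbb N=\{0,1,2,\dots\}$. Bold letters are $n$-tuples: variables $\mathbf z=(z_1,\dots,z_n)$, multi-indices in $\mathbb N^n$; $\mathbf 0,\mathbf 1$ are constant tuples; $\mathbf k\ge\mathbf j$ is componentwise; $|\mathbf k|=\sum k_i$; $\mathbf z^{\mathbf k}=\prod z_i^{k_i}$; $\binom{\mathbf k}{\mathbf j}=\prod\binom{k_i}{j_i}$. For a $\mathbb Z$-graded $R$-module, $p(a)$ is the degree of a homogeneous element and $p(a,b)=(-1)^{p(a)p(b)}$. Formal calculus. $\mathcal K^{\mathbf z}_{\mathrm{dist}}(V)$ is the graded $R$-module of series $A(\mathbf z)=\sum_{\mathbf k\ge\mathbf 0}(\mathbf z^{\mathbf k}A_{-\mathbf 1-\mathbf k}+\Omega^{\mathbf k}_{\mathbf z}A_{\mathbf k})$ with coefficients in $V$, where the $z_i$ have degree $0$ and the symbols $\Omega_{\mathbf z}^{\mathbf k}$ have degree $N$; $V\langle\!\langle\mathbf z\rangle\!\rangle$ is the submodule of series for which there is $\mathbf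 K$ with $A_{\mathbf k}=0$ unless $\mathbf k\le\mathbf K$. $\mathcal K^{\mathbf z,\mathbf w}_{\mathrm{dist}}(V)$ consists of all formal series in $\mathbf z^{\mathbf j}\mathbf w^{\mathbf k}$, $\mathbf z^{\mathbf j}\Omega^{\mathbf k}_{\mathbf w}$, $\mathbf w^{\mathbf j}\Omega^{\mathbf k}_{\mathbf z}$, $\Omega^{\mathbf j}_{\mathbf z}\Omega^{\mathbf k}_{\mathbf w}$. Products (when no infinite sums of coefficients occur) are given by $\mathbf z^{\mathbf j}\Omega^{\mathbf k}_{\mathbf z}=\Omega^{\mathbf k-\mathbf j}_{\mathbf z}$ if $\mathbf k\ge\mathbf j$ and $0$ otherwise, $\Omega^{\mathbf j}_{\mathbf z}\Omega^{\mathbf k}_{\mathbf z}=0$, $\Omega^{\mathbf j}_{\mathbf z}\Omega^{\mathbf k}_{\mathbf w}=(-1)^N\Omega^{\mathbf k}_{\mathbf w}\Omega^{\mathbf j}_{\mathbf z}$, variables commute with everything, and a homogeneous coefficient $a$ satisfies $a\Omega=(-1)^{p(a)N}\Omega a$. Hasse derivatives: $\partial^{(\mathbf j)}_{\mathbf z}\mathbf z^{\mathbf k}=\binom{\mathbf k}{\mathbf j}\mathbf z^{\mathbf k-\mathbf j}$, $\partial^{(\mathbf j)}_{\mathbf z}\Omega^{\mathbf k}_{\mathbf z}=(-1)^{|\mathbf j|}\binom{\mathbf k+\mathbf j}{\mathbf j}\Omega^{\mathbf k+\mathbf j}_{\mathbf z}$; in a product $\partial^{(\mathbf k)}FG$ the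 derivative acts on $F$ only. Residue: $\operatorname{Res}_{\mathbf z}(\mathbf z^{\mathbf j}f(\mathbf w))=0$, $\operatorname{Res}_{\mathbf z}(\Omega^{\mathbf j}_{\mathbf z}f(\mathbf w))=\delta_{\mathbf j,\mathbf 0}f(\mathbf w)$. $\Delta(\mathbf z,\mathbf w)=\sum_{\mathbf j\ge\mathbf 0}\big(\mathbf w^{\mathbf j}\Omega^{\mathbf j}_{\mathbf z}+(-1)^N\mathbf z^{\mathbf j}\Omega^{\mathbf j}_{\mathbf w}\big)$. Fields. A cohomological field on $V$ is $A(\mathbf z)=\sum_{\mathbf j}(\mathbf z^{\mathbf j}A_{(-\mathbf 1-\mathbf j)}+\Omega^{\mathbf j}_{\mathbf z}A_{(\mathbf j)})\in\mathcal K^{\mathbf z}_{\mathrm{dist}}(\operatorname{End}V)$ with $A(\mathbf z)v\in V\langle\!\langle\mathbf z\rangle\!\rangle$ for all $v$; it is homogeneous of degree $p(A)$ if each $A_{(-\mathbf 1-\mathbf j)}$ has degree $p(A)$ and each $A_{(\mathbf j)}$ has degree $p(A)-N$. $[A(\mathbf z),B(\mathbf w)]=A(\mathbf z)B(\mathbf w)-p(A,B)B(\mathbf w)A(\mathbf z)$, extended bilinearly. A series $f(\mathbf z,\mathbf w)$ is local if $f=\sum_{\mathbf 0\le\mathbf j\le\mathbf K}\partial^{(\mathbf j)}_{\mathbf w}\Delta(\mathbf z,\mathbf w)g^{\mathbf j}(\mathbf w)$ for some $\mathbf K\in\mathbb N^n$, with $g^{\mathbf j}(\mathbf w)=\operatorname{Res}_{\mathbf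 z}((\mathbf z-\mathbf w)^{\mathbf j}f)$. Fields $A,B$ are mutually local if $[A(\mathbf z),B(\mathbf w)]\in\mathcal K^{\mathbf z,\mathbf w}_{\mathrm{dist}}(\operatorname{End}V)$ is local. An $(n,N)$-cohomological vertex algebra (CVA) $(V,Y,e^{\mathbf z\cdot\mathbf T},|0\rangle)$ over $R$ consists of a $\mathbb Z$-graded $R$-module $V$; a degree $0$ $R$-linear map $Y$, $a\mapsto Y(a,\mathbf z)=\sum_{\mathbf j}(\mathbf z^{\mathbf j}a_{(-\mathbf 1-\mathbf j)}+\Omega^{\mathbf j}_{\mathbf z}a_{(\mathbf j)})\in\mathcal K^{\mathbf z}_{\mathrm{dist}}(\operatorname{End}V)$ (for homogeneous $a$, $a_{(-\mathbf 1-\mathbf j)}$ has degree $p(a)$ and $a_{(\mathbf j)}$ degree $p(a)-N$); degree $0$ endomorphisms $T^{(\mathbf j)}$, $\mathbf j\ge\mathbf 0$, with $T^{(\mathbf 0)}=\mathrm{id}_V$, assembled as $e^{\mathbf z\cdot\mathbf T}=\sum_{\mathbf j}\mathbf z^{\mathbf j}T^{(\mathbf j)}$; and a vacuum $|0\rangle\in V^0$; such that for all $a,b\in V$: (V1) $Y(a,\mathbf z)b\in V\langle\!\langle\mathbf z\rangle\!\rangle$; (V2) $Y(|0\rangle,\mathbf z)=\mathrm{id}_V$; (V3) $Y(a,\mathbf z)|0\rangle=e^{\mathbf z\cdot\mathbf T}a$; (V4) $e^{\mathbf w\cdot\mathbf T}Y(a,\mathbf z)e^{-\mathbf w\cdot\mathbf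 T}=Y(a,\mathbf z+\mathbf w):=\sum_{\mathbf k}\mathbf w^{\mathbf k}\partial^{(\mathbf k)}_{\mathbf z}Y(a,\mathbf z)$; (V5) for homogeneous $a,b$, $Y(a,\mathbf z)$ and $Y(b,\mathbf w)$ are mutually local. *)

(* Defs.v *)
From HB Require Import structures.
From mathcomp Require Import all_boot all_order all_algebra.
From mathcomp Require Import boolp classical_sets functions fsbigop.
From mathcomp Require Import mpoly.

Set Implicit Arguments.
Unset Strict Implicit.
Unset Printing Implicit Defensive.

Import GRing.Theory.

Local Open Scope classical_set_scope.
Local Open Scope ring_scope.

(* The sign (-1)^(pq) for p, q : int, in an arbitrary ring. *)
Definition ksign (R : pzRingType) (p q : int) : R := (-1) ^+ `|(p * q)%R|%N.

Record gradedLmod (R : pzRingType) := GradedLmod {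
  gr_sort :> lmodType R;
  homogeneous : int -> set gr_sort;
  homogeneous0 : forall d, homogeneous d 0;
  homogeneousP : forall d (c : R) x y,
    homogeneous d x -> homogeneous d y -> homogeneous d (c *: x + y);
  (* The last two axioms say that the module is the direct sum of its
     homogeneous parts. *)
  homogeneous_span : forall v, exists (D : seq int) (x : int -> gr_sort),
    (forall d, homogeneous d (x d)) /\ v = \sum_(d <- D) x d;
  homogeneous_indep : forall (D : seq int) (x : int -> gr_sort),
    uniq D -> (forall d, homogeneous d (x d)) -> \sum_(d <- D) x d = 0 ->
    forall d, d \in D -> x d = 0
}.

Definition has_degree (R : pzRingType) (V : gradedLmod R) (d : int)
    (f : V -> V) : Prop :=
  forall (e : int) (v : V), homogeneous e v -> homogeneous (e + d) (f v).

(* [inl j] stands for z^j and [inr j] for Omega_z^j. *)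
Definition mono (n : nat) : Type := ('X_{1..n} + 'X_{1..n})%type.

(* [A (inl j)] is the coefficient A_(-1-j) of z^j and [A (inr j)] is the
   coefficient A_(j) of Omega_z^j, the coefficient standing on the right. *)
Definition kdist (n : nat) (M : Type) : Type := mono n -> M.

(* [f m l] is the coefficient of the product of the z-monomial [m] by the
   w-monomial [l], in this order, the coefficient standing on the right. *)
Definition kdist2 (n : nat) (M : Type) : Type := mono n -> mono n -> M.

Section Calculus.

Variables (n : nat) (N : int).

Implicit Types (j k : 'X_{1..n}) (m l : mono n).

Definition mono_deg m : int := if m is inr _ then N else 0.

(* [None] stands for a vanishing product. *)
Definition mono_mul m l : option (mono n) :=
  match m, l with
  | inl j, inl k => Some (inl (j + k)%MM)
  | inl j, inr k | inr k, inl j =>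
      if (j <= k)%MM then Some (inr (k - j)%MM) else None
  | inr _, inr _ => None
  end.

Definition mbinom k j : nat := \prod_(i < n) 'C(k i, j i).

Variable R : comPzRingType.

Definition hasse (M : lmodType R) j (A : kdist n M) : kdist n M :=
  fun m => match m with
  | inl k => A (inl (k + j)%MM) *+ mbinom (k + j)%MM j
  | inr k => (-1) ^+ mdeg j *: (A (inr (k - j)%MM) *+ mbinom k j)
  end.

Definition hasse_w (M : lmodType R) j (f : kdist2 n M) : kdist2 n M :=
  fun m => hasse j (f m).

(* Product of a series with scalar coefficients (these have degree 0) by a
   series with coefficients in M. The sign comes from moving the w-monomial of
   F past the z-monomial of G. The sum is over a possibly infinite set, but is
   only meaningful (and only used below) when it has finite support. *)
Definition smul (M : lmodType R) (F : kdist2 n R) (G : kdist2 n M) :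
    kdist2 n M :=
  fun m l =>
    \sum_(x \in [set x : (mono n * mono n) * (mono n * mono n) |
                 mono_mul x.1.1 x.2.1 = Some m /\
                 mono_mul x.1.2 x.2.2 = Some l])
      (ksign R (mono_deg x.1.2) (mono_deg x.2.1) * F x.1.1 x.1.2)
        *: G x.2.1 x.2.2.

Definition in_w (M : lmodType R) (g : kdist n M) : kdist2 n M :=
  fun m l => if m == inl 0%MM then g l else 0.

Definition z_sub_w (i : 'I_n) : kdist2 n R := fun m l =>
  ((m == inl U_(i)%MM) && (l == inl 0%MM))%:R
  - ((m == inl 0%MM) && (l == inl U_(i)%MM))%:R.

(* (z - w)^j f, where (z - w)^j is the product of the (z_i - w_i)^(j_i). *)
Definition z_sub_w_pow (M : lmodType R) j (f : kdist2 n M) : kdist2 n M :=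
  foldr (fun i : 'I_n => iter (j i) (smul (z_sub_w i))) f (enum 'I_n).

Definition res_z (M : lmodType R) (f : kdist2 n M) : kdist n M :=
  f (inr 0%MM).

Definition Delta : kdist2 n R := fun m l =>
  match m, l with
  | inr j, inl k => (j == k)%:R
  | inl j, inr k => (-1) ^+ `|N|%N * (j == k)%:R
  | _, _ => 0
  end.

Definition is_local (M : lmodType R) (f : kdist2 n M) : Prop :=
  exists K : 'X_{1..n},
    f = \sum_(j \in [set j : 'X_{1..n} | (j <= K)%MM])
          smul (hasse_w j (Delta : kdist2 n R^o))
               (in_w (res_z (z_sub_w_pow j f))).

End Calculus.

(* Series with coefficients in End V are series with coefficients in the
   R-module V -> V all of whose coefficients are linear. *)
Section Fields.

Variables (n : nat) (N : int) (R : comPzRingType) (V : gradedLmod R).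

Implicit Types (A B : kdist n (V -> V)) (p q : int).

Definition is_field A : Prop :=
  (forall m, linear (A m)) /\
  (forall v : V, exists K : 'X_{1..n},
     forall k : 'X_{1..n}, ~~ (k <= K)%MM -> A (inr k) v = 0).

Definition homogeneous_series p A : Prop :=
  forall m, linear (A m) /\ has_degree (p - mono_deg N m) (A m).

(* A(z)B(w) for A homogeneous of degree p: the coefficient of A, which has
   degree p - deg m, moves past the w-monomial l. *)
Definition mul_zw p A B : kdist2 n (V -> V) := fun m l =>
  ksign R (p - mono_deg N m) (mono_deg N l) *: (A m \o B l).

(* B(w)A(z) for B homogeneous of degree q: the coefficient of B moves past the
   z-monomial m, then the w-monomial l moves past m. *)
Definition mul_wz q B A : kdist2 n (V -> V) := fun m l =>
  (ksign R (mono_deg N l) (mono_deg N m)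
   * ksign R (q - mono_deg N l) (mono_deg N m)) *: (B l \o A m).

Definition homog_bracket p q A B : kdist2 n (V -> V) :=
  mul_zw p A B - ksign R p q *: mul_wz q B A.

(* [C] is the bracket [A(z), B(w)], extended bilinearly from homogeneous
   series to finite sums of homogeneous series. *)
Definition is_bracket A B (C : kdist2 n (V -> V)) : Prop :=
  exists (D E : seq int) (A_ B_ : int -> kdist n (V -> V)),
    [/\ (forall p, homogeneous_series p (A_ p)) /\ A = \sum_(p <- D) A_ p,
        (forall q, homogeneous_series q (B_ q)) /\ B = \sum_(q <- E) B_ q
      & C = \sum_(p <- D) \sum_(q <- E) homog_bracket p q (A_ p) (B_ q)].

Definition mutually_local A B : Prop :=
  exists2 C : kdist2 n (V -> V), is_bracket A B C & is_local N C.

End Fields.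

Record CVA (n : nat) (N : int) (R : comPzRingType) := MkCVA {
  cva_mod :> gradedLmod R;
  cva_Y : {linear cva_mod -> kdist n (cva_mod -> cva_mod)};
  cva_T : 'X_{1..n} -> {linear cva_mod -> cva_mod};
  cva_vac : cva_mod;
  cva_Y_linear : forall a m, linear (cva_Y a m);
  cva_Y_degree : forall d a, homogeneous d a -> homogeneous_series N d (cva_Y a);
  cva_T_degree : forall j, has_degree 0 (cva_T j);
  cva_T0 : forall v, cva_T 0%MM v = v;
  cva_vac_degree : homogeneous 0 cva_vac;
  cva_Y_field : forall a, is_field (cva_Y a);
  cva_Y_vac : forall m v,
    cva_Y cva_vac m v = if m == inl 0%MM then v else 0;
  cva_creation : forall a m,
    cva_Y a m cva_vac = if m is inl j then cva_T j a else 0;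
  (* The coefficients of w^k in e^(w.T) Y(a, z) e^(-w.T) and Y(a, z + w). *)
  cva_translation : forall a (k : 'X_{1..n}) m v,
    \sum_(i \in [set i : 'X_{1..n} | (i <= k)%MM])
      (-1) ^+ mdeg (k - i)%MM *: cva_T i (cva_Y a m (cva_T (k - i)%MM v))
    = hasse k (cva_Y a) m v;
  cva_locality : forall d e a b, homogeneous d a -> homogeneous e b ->
    mutually_local N (cva_Y a) (cva_Y b)
}.

(* Main.v *)
Require Import Defs.
From HB Require Import structures.
From mathcomp Require Import all_boot all_order all_algebra.
From mathcomp Require Import boolp classical_sets functions fsbigop.
From mathcomp Require Import mpoly.

Set Implicit Arguments.
Unset Strict Implicit.
Unset Printing Implicit Defensive.

Import GRing.Theory.

Local Open Scope classical_set_scope.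
Local Open Scope ring_scope.

(** The classical argument multiplies by a power of [z - w] and cancels it. Here
    this fails, since powers of [z] kill singular monomials [Omega_z^k]. Instead
    the proof uses how rigid local series are.

    Let [b] be homogeneous, and apply the brackets of [A(z)] and of [Y(a, z)]
    with [Y(b, w)] to the vacuum. As [A(z)] and [Y(a, z)] agree on the vacuum,
    the terms in which [Y(b, w)] stands on the left are the same in both
    brackets; as [Y(b, w)] applied to the vacuum is regular in [w], the other
    terms contain no [Omega_w]. So the two brackets, applied to the vacuum, have
    the same [z^m Omega_w^s] coefficients, and their [w^0] coefficients differ
    by [A(z) b - Y(a, z) b].

    It remains to see that the [w^0] part of a local series is determined by its
    [z^m Omega_w^s] part ([local_eq_vector]). The coefficient of
    [z^m Omega_w^(m + k)] in the sum of the [j]-th derivatives of Delta times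
    [g j] is, up to a sign, the sum over [j] of [mbinom (m + j) j] times an
    unknown [x j] independent of [m], where [x k] is, up to a sign, the
    coefficient of [Omega_z^k w^0] ([local_coefficients]). The functions
    [m |-> mbinom (m + j) j] are linearly independent, even with coefficients in
    an arbitrary abelian group ([mbinom_shift_sum_eq0]), so [x k] can be
    recovered; the coefficients of [z^m w^0] vanish anyway ([local_zw_eq0]).

    The bracket is defined through decompositions into homogeneous series;
    [is_bracket_homogE] shows that for homogeneous series these do not matter.
    Finally the vectors [b] span, and the coefficients are linear. *)

(** * Multi-binomial coefficients *)

Section Binomials.

Variable n : nat.

Implicit Types j k m d : 'X_{1..n}.

Lemma mbinom_sym m j : mbinom (m + j)%MM j = mbinom (m + j)%MM m.
Proof.
apply: eq_bigr => i _; rewrite mnmDE -bin_sub ?leq_addl //.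
by rewrite addnK.
Qed.

Lemma mbinomnn k : mbinom k k = 1%N.
Proof. by apply: big1 => i _; rewrite binn. Qed.

Lemma mbinom_small k j : ~~ (j <= k)%MM -> mbinom k j = 0%N.
Proof.
case/forallPn => i; rewrite -ltnNge => lt_ki.
by rewrite /mbinom (bigD1 i) //= bin_small.
Qed.

Lemma mbinom_pascal i k j :
  mbinom (k + U_(i))%MM (j + U_(i))%MM
    = (mbinom k (j + U_(i))%MM + mbinom k j)%N.
Proof.
rewrite /mbinom.
have off_i (c : 'I_n) l : c != i -> (l + U_(i))%MM c = l c.
  by rewrite eq_sym mnmDE mnm1E => /negbTE->; rewrite addn0.
rewrite !(bigD1 (P := predT) i) //= !mnmDE !mnm1E eqxx !addn1 binS mulnDl.
by congr (_ * _ + _ * _)%N; apply: eq_bigr => c ci; rewrite !off_i.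
Qed.

Lemma submm k : (k - k)%MM = 0%MM.
Proof. by rewrite -{1}[k]add0m addmK. Qed.

Lemma mnm_addU_ind (P : 'X_{1..n} -> Prop) :
  P 0%MM -> (forall i d, P d -> P (d + U_(i))%MM) -> forall d, P d.
Proof.
move=> P0 PS d; have [c] := ubnP (mdeg d).
elim: c d => // c IHc d; rewrite ltnS => le_dc.
have [->//|nz_d] := eqVneq d 0%MM.
have [i d_i]: exists i, (U_(i) <= d)%MM.
  apply/existsP; apply: contraR nz_d => /existsPn d0; apply/eqP/mnmP => i.
  by move: (d0 i); rewrite lep1mP negbK mnm0E => /eqP.
rewrite -(submK d_i); apply/PS/IHc.
by move: le_dc; rewrite -{1}(submK d_i) mdegD mdeg1 addn1.
Qed.

End Binomials.

(** Trades the box of multi-indices below [K] for a finite type that does not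
    depend on [K], so that two local series of different orders can be
    expanded over a common index set. *)
Lemma fsum_le_bmultinom n (K : 'X_{1..n}) B (M : nmodType)
    (F : 'X_{1..n} -> M) :
  (mdeg K < B)%N ->
  \sum_(j \in [set j : 'X_{1..n} | (j <= K)%MM]) F j
    = \sum_(j : 'X_{1..n < B} | (j <= K)%MM) F j.
Proof.
move=> lt_KB.
pose r := [seq j <- map (@bmnm n B) (enum {: 'X_{1..n < B}}) | (j <= K)%MM].
rewrite (fsbigE r); first last.
- move=> j /= le_jK; rewrite mem_filter le_jK /=.
  case/negP; apply/mapP.
  have lt_jB : (mdeg j < B)%N.
    by apply: leq_ltn_trans lt_KB; rewrite -(submK le_jK) mdegD leq_addl.
  by exists (BMultinom lt_jB); rewrite ?mem_enum.
- by move=> j; rewrite /= mem_filter => /andP[].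
- by rewrite filter_uniq // map_inj_uniq ?enum_uniq //; apply: val_inj.
rewrite big_filter_cond big_map big_enum_cond /=.
by apply: eq_bigl => j; rewrite mem_setE unfold_in andbb.
Qed.

(** * Products with series in the second variable *)

Section ScalarProduct.
Variables (n : nat) (N : int) (R : comPzRingType) (M : lmodType R).

(** When [u] is the only w-monomial of [F] next to the z-monomial [m], the
    convolution collapses to the products of [u] by the monomials of [g].
    Derivatives of Delta have such a [u] for every [m]. *)
Lemma smul_in_w (F : kdist2 n R) (g : kdist n M) (m l u : mono n) :
  (forall u', u' != u -> F m u' = 0) ->
  smul N F (in_w g) m l
    = \sum_(y \in [set y | mono_mul u y = Some l]) F m u *: g y.
Proof.
move=> Fu; rewrite /smul.
pose h (y : mono n) : (mono n * mono n) * (mono n * mono n) :=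
  ((m, u), (inl 0%MM, y)).
have mul1 (m' : mono n) : mono_mul m' (inl 0%MM) = Some m'.
  case: m' => j /=; first by rewrite addm0.
  by rewrite subm0; case: mnm_lepP => // -[] i; rewrite mnm0E.
transitivity (\sum_(x \in h @` [set y | mono_mul u y = Some l])
    (ksign R (mono_deg N x.1.2) (mono_deg N x.2.1) * F x.1.1 x.1.2)
        *: in_w g x.2.1 x.2.2).
  apply/esym/fsbig_widen.
    by move=> _ [y /= yl <-] /=; rewrite mul1.
  move=> [[m' u'] [v y]] [] /= [mE lE] nh.
  rewrite /in_w; case: eqVneq => [v0|_]; last by rewrite scaler0.
  move: mE nh; rewrite v0 mul1 => -[->] nh.
  have [uE|/Fu->] := eqVneq u' u; last by rewrite mulr0 scale0r.
  by case: nh; exists y; rewrite /h ?uE // -uE.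
rewrite fsbig_image; last by move=> y y' _ _ [].
by apply: eq_fsbigr => y _; rewrite /= /in_w eqxx /ksign mulr0 mul1r.
Qed.
End ScalarProduct.

(** * Independence of shifted binomials *)

Section ShiftedBinomials.
Variables (n : nat) (M : zmodType) (B : nat) (x : 'X_{1..n} -> M).

(** The functions [m |-> mbinom (m + j) j] are linearly independent, even with
    coefficients in an abelian group with torsion. By the Pascal rule, a finite
    difference in direction [i] raises the lower index: iterating, the relation
    propagates from [mbinom (m + j) m] to [mbinom (m + j) (m + d)] for every
    [d]. At [m = 0] this is the unitriangular system with matrix [mbinom j d],
    solved by descending induction on the degree. *)
Lemma mbinom_shift_sum_eq0 :
  (forall m : 'X_{1..n},
     \sum_(j : 'X_{1..n < B}) x j *+ mbinom (m + j)%MM j = 0) ->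
  forall j : 'X_{1..n < B}, x j = 0.
Proof.
move=> x0.
(* The start [d = 0] is the hypothesis, by the symmetry of binomials. *)
have diff d : forall m,
    \sum_(j : 'X_{1..n < B}) x j *+ mbinom (m + j)%MM (m + d)%MM = 0.
  elim/mnm_addU_ind: d => [|i d IHd] m.
    by apply: etrans (x0 m); apply: eq_bigr => j _; rewrite addm0 mbinom_sym.
  have mUE e : (m + U_(i) + e = m + e + U_(i))%MM.
    by rewrite -!addmA (addmC U_(i)%MM).
  transitivity (\sum_(j : 'X_{1..n < B})
     (x j *+ mbinom (m + U_(i) + j)%MM (m + U_(i) + d)%MM
      - x j *+ mbinom (m + j)%MM (m + d)%MM)); last by rewrite sumrB !IHd subr0.
  apply: eq_bigr => j _.
  by rewrite !mUE mbinom_pascal mulrnDr addrK addmA.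
have bin0 d : \sum_(j : 'X_{1..n < B}) x j *+ mbinom j d = 0.
  by apply: etrans (diff d 0%MM); apply: eq_bigr => j _; rewrite !add0m.
move=> j; have [c] := ubnP (B - mdeg j); elim: c j => // c IHc j.
rewrite ltnS => le_c; move: (bin0 j); rewrite (bigD1 j) //= mbinomnn mulr1n.
rewrite big1 ?addr0 // => k /eqP ne_kj.
have [le_jk|/mbinom_small-> //] := boolP (j <= k)%MM.
rewrite IHc ?mul0rn //; apply: leq_trans le_c; apply: ltn_sub2l.
  exact: bmdeg.
rewrite -(submK le_jk) mdegD -[X in (X < _)%N]add0n ltn_add2r lt0n mdeg_eq0.
apply: contra_not_neq ne_kj => kj0; apply: val_inj.
by rewrite /= -(submK le_jk) kj0 add0m.
Qed.
End ShiftedBinomials.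

(** * Coefficients of local series *)

Section Locality.
Variables (n : nat) (N : int) (R : comPzRingType) (M : lmodType R).
Implicit Types (j k m : 'X_{1..n}) (f : kdist2 n M) (g : kdist n M).

(** The summands of the expansion that defines locality, with free coefficient
    series. *)
Definition delta_term j g : kdist2 n M :=
  smul N (hasse_w j (Delta N R : kdist2 n R^o)) (in_w g).

(** Next to [z^m] the only w-monomial of the derivative of Delta is
    [Omega_w^(m + j)], with coefficient, up to sign, the shifted
    binomial. *)
Lemma delta_term_inl j g m (l : mono n) :
  delta_term j g (inl m) l =
    if l is inr s then
      if (s <= m + j)%MM then
        ((-1) ^+ `|N|%N * (-1) ^+ mdeg j)
          *: (g (inl (m + j - s)%MM) *+ mbinom (m + j)%MM j)
      else 0
    else 0.
Proof.
rewrite /delta_term (@smul_in_w _ _ _ _ _ _ _ _ (inr (m + j)%MM)).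
  case: l => s; first by apply: fsbig1; case=> y //=; case: ifP.
  case: ifP => [le_s|nle_s]; last first.
    apply: fsbig1; case=> y //=; case: ifP => // le_y [sE].
    by rewrite -sE lem_subr in nle_s.
  have -> : [set y | mono_mul (inr (m + j)%MM) y = Some (inr s)]
          = [set inl (m + j - s)%MM].
    apply/seteqP; split=> [[y|y]|_ ->] //=.
      by case: ifP => // le_y [<-]; rewrite submBA // addmC addmK.
    by rewrite lem_subr submBA // addmC addmK.
  rewrite fsbig_set1 /= addmK eqxx mulr1 -scalerMnr scalerMnl -mulr_natr.
  rewrite -[in RHS]scaler_nat [RHS]scalerA -mulrA; congr (_ *: _).
  exact: mulrC.
case=> k ne_k; rewrite /= ?mul0rn //.
case: eqVneq => [mE|_]; last by rewrite mulr0 mul0rn scaler0.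
rewrite mbinom_small ?mulr0n ?scaler0 //.
by apply: contra_neqN ne_k => le_jk; rewrite mE submK.
Qed.

(** Next to [Omega_z^k] the only w-monomial is [w^(k - j)], which contributes to
    [w^0] only for [j = k]. *)
Lemma delta_term_inr0 j g k :
  delta_term j g (inr k) (inl 0%MM) = if j == k then g (inl 0%MM) else 0.
Proof.
rewrite /delta_term (@smul_in_w _ _ _ _ _ _ _ _ (inl (k - j)%MM)); last first.
  case=> y ne_y; rewrite /= ?mul0rn ?scaler0 //.
  case: eqVneq => [kE|_]; last by rewrite mul0rn.
  by rewrite kE addmK eqxx in ne_y.
case: eqVneq => [->|ne_jk].
  rewrite submm.
  have -> : [set y : mono n | mono_mul (inl 0%MM) y = Some (inl 0%MM)]
          = [set inl 0%MM].
    apply/seteqP; split=> [[y|y]|_ ->] /=; rewrite ?add0m //.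
      by case=> ->.
    by case: ifP.
  by rewrite fsbig_set1 /= add0m eqxx mbinomnn scale1r.
apply: fsbig1; case=> y /=; last by case: ifP.
move=> /(congr1 (fun o => if o is Some (inl i) then i else k)) /= E.
move/eqP: E; rewrite mnmD_eq0 => /andP[/eqP-> _].
by rewrite add0m eq_sym (negbTE ne_jk) mul0rn scale0r.
Qed.

Lemma local_expansion f : is_local N f ->
  exists (K : 'X_{1..n}) (g : 'X_{1..n} -> kdist n M),
    forall B, (mdeg K < B)%N -> forall (m l : mono n),
      f m l = \sum_(j : 'X_{1..n < B} | (j <= K)%MM) delta_term j (g j) m l.
Proof.
case=> K fE; exists K, (fun j => res_z (z_sub_w_pow N j f)) => B lt_KB m l.
by rewrite {1}fE (fsum_le_bmultinom _ lt_KB) !fct_sumE.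
Qed.

(** The same unknowns [x j], up to sign the coefficients of [w^(j - k)] in the
    [j]-th coefficient series, govern both parts of the series: their shifted
    binomial combinations are the coefficients of [z^m Omega_w^(m + k)], and
    [x k] itself is the coefficient of [Omega_z^k w^0]. *)
Lemma local_coefficients f : is_local N f ->
  exists B0, forall B k, (B0 <= B)%N -> exists x : 'X_{1..n} -> M,
    (forall m, f (inl m) (inr (m + k)%MM)
       = (-1) ^+ `|N|%N *: \sum_(j : 'X_{1..n < B}) x j *+ mbinom (m + j)%MM j)
    /\ ((mdeg k < B)%N -> f (inr k) (inl 0%MM) = (-1) ^+ mdeg k *: x k).
Proof.
case/local_expansion=> K [g gE]; exists (mdeg K).+1 => B k lt_KB.
have fE := gE B lt_KB.
exists (fun j => if (j <= K)%MM && (k <= j)%MM then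
  (-1) ^+ mdeg j *: g j (inl (j - k)%MM) else 0); split=> [m|lt_kB].
  rewrite fE scaler_sumr big_mkcond /=; apply: eq_bigr => j _.
  case: ifP => _ /=; last by rewrite mul0rn scaler0.
  rewrite delta_term_inl.
  have -> : ((m + k <= m + j) = (k <= j))%MM.
    by apply: eq_forallb => i; rewrite !mnmDE leq_add2l.
  case: ifP => _; last by rewrite mul0rn scaler0.
  rewrite -submDA (addmC m) addmK -scalerA; congr (_ *: _).
  by rewrite -scalerMnr.
rewrite fE lepm_refl andbT submm; case: ifP => [le_kK|nle_kK].
  rewrite (bigD1 (BMultinom lt_kB)) //= delta_term_inr0 eqxx big1.
    by rewrite addr0 scalerA -expr2 sqrr_sign scale1r.
  by move=> j /andP[_ ne_jk]; rewrite delta_term_inr0 ifN.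
rewrite scaler0 big1 // => j le_jK; rewrite delta_term_inr0 ifN //.
by apply: contraTneq le_jK => ->; rewrite nle_kK.
Qed.

(** Delta has no [z^m w^k] terms, and multiplying by a series in [w] cannot
    turn an [Omega_w] into a power of [w]. *)
Lemma local_zw_eq0 f : is_local N f -> forall m k, f (inl m) (inl k) = 0.
Proof.
case/local_expansion=> K [g fE] m k; rewrite (fE _ (ltnSn _)).
by rewrite big1 // => j _; rewrite delta_term_inl.
Qed.

End Locality.

(** The independence of shifted binomials recovers the unknowns of
    [local_coefficients] from the [z^m Omega_w^s] part of the series, hence also
    its [w^0] part. Both parts are applied to a vector because the brackets to
    be compared only agree on the vacuum. *)
Lemma local_eq_vector n (N : int) (R : comPzRingType) (T : Type)
    (W : lmodType R) (f1 f2 : kdist2 n (T -> W)) (v : T) :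
  is_local N f1 -> is_local N f2 ->
  (forall m s, f1 (inl m) (inr s) v = f2 (inl m) (inr s) v) ->
  forall m, f1 m (inl 0%MM) v = f2 m (inl 0%MM) v.
Proof.
move=> loc1 loc2 eq_zO [m|k]; first by rewrite !(local_zw_eq0 (N := N)).
have [B1 coef1] := local_coefficients loc1.
have [B2 coef2] := local_coefficients loc2.
(* Large enough to expand both series and to see the index [k]. *)
pose B := (B1 + B2 + mdeg k).+1.
have le_B1 : (B1 <= B)%N by rewrite leqW // -addnA leq_addr.
have le_B2 : (B2 <= B)%N by rewrite leqW // addnAC leq_addl.
have lt_kB : (mdeg k < B)%N by rewrite ltnS leq_addl.
have [x1 [zO1 Ow1]] := coef1 B k le_B1; have [x2 [zO2 Ow2]] := coef2 B k le_B2.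
rewrite Ow1 // Ow2 //=; congr (_ *: _); apply/eqP; rewrite -subr_eq0; apply/eqP.
apply: (mbinom_shift_sum_eq0 (B := B) (x := fun j => x1 j v - x2 j v) _
          (BMultinom lt_kB)) => m.
have:= eq_zO m (m + k)%MM; rewrite zO1 zO2 !fct_sumE /=.
move/(can_inj (signrZK _))/eqP; rewrite -subr_eq0 -sumrB => /eqP x0.
apply: etrans x0; apply: eq_bigr => j _; rewrite mulrnBl.
by rewrite !natmulfctE.
Qed.

(** * Brackets of homogeneous series *)

Section LinearFunctions.
Variables (R : pzRingType) (U W : lmodType R) (f : U -> W).
Hypothesis f_lin : linear f.

Lemma linear_fun0 : f 0 = 0.
Proof. by have := f_lin (-1) 0 0; rewrite scaler0 addr0 scaleN1r addNr. Qed.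

Lemma linear_funZ c v : f (c *: v) = c *: f v.
Proof. by rewrite -[_ *: _ in LHS]addr0 f_lin linear_fun0 addr0. Qed.

Lemma linear_fun_sum (I : Type) (r : seq I) (F : I -> U) :
  f (\sum_(i <- r) F i) = \sum_(i <- r) f (F i).
Proof.
apply: big_morph => [u v|]; last exact: linear_fun0.
by rewrite -{1}[u]scale1r f_lin scale1r.
Qed.
End LinearFunctions.

Section Graded.
Variables (R : comPzRingType) (V : gradedLmod R).
Implicit Types (p q d e : int) (u v : V).

Lemma homogeneousZ d (c : R) v : homogeneous d v -> homogeneous d (c *: v).
Proof.
by move=> Hv; rewrite -[_ *: _]addr0; apply/homogeneousP/homogeneous0.
Qed.

Lemma homogeneousD d u v :
  homogeneous d u -> homogeneous d v -> homogeneous d (u + v).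
Proof. by move=> Hu Hv; rewrite -[u]scale1r; apply: homogeneousP. Qed.

(** Since homogeneous components are unique, all summands of [y] whose index is
    not [p] cancel, and those of index [p] add up to [y]. Scaling the summands
    by degree-dependent factors therefore only sees the factor of degree [p].
    The indices in [D] may repeat, hence the multiplicities in the proof. *)
Lemma homogeneous_sum_scale (D : seq int) (s p : int) (x : int -> V) (y : V)
    (c : int -> R) :
  (forall d, homogeneous (s + d) (x d)) -> homogeneous (s + p) y ->
  y = \sum_(d <- D) x d -> \sum_(d <- D) c d *: x d = c p *: y.
Proof.
move=> x_hom y_hom yE.
pose E := undup (p :: D).
pose x' d := x d *+ count_mem d D - (if d == p then y else 0).
have E_uniq : uniq E by apply: undup_uniq.
have sumE (F : int -> V) :
    \sum_(d <- D) F d = \sum_(d <- E) F d *+ count_mem d D.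
  rewrite -big_undup_iterop_count /E /=; case: ifP => [_|/negbT/count_memPn pD].
    by [].
  by rewrite big_cons pD add0r.
have sum1 (F : int -> V) : F p = \sum_(d <- E) if d == p then F d else 0.
  rewrite -big_mkcond -big_filter filter_pred1_uniq ?big_seq1 //.
  by rewrite mem_undup mem_head.
have x'0 d : d \in E -> x' d = 0.
  have shift_uniq : uniq [seq s + e | e <- E]
    by rewrite map_inj_uniq //; apply: addrI.
  have shift_hom e : homogeneous e (x' (e - s)).
    rewrite -[e in homogeneous e](subrKC s); set d' := e - s.
    rewrite /x' -scaler_nat -scaleN1r.
    apply/homogeneousD; apply/homogeneousZ=> //.
    by case: eqP => [->|_] //; apply: homogeneous0.
  have shift_sum0 : \sum_(e <- [seq s + e | e <- E]) x' (e - s) = 0.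
    rewrite big_map (eq_bigr x') => [|e _]; last by rewrite addrC addKr.
    by rewrite sumrB -sumE -yE -(sum1 (fun=> y)) subrr.
  move=> dE; have := homogeneous_indep shift_uniq shift_hom
    shift_sum0 (map_f _ dE).
  by rewrite /= addrC addKr.
rewrite sumE -[RHS]/((fun d => c d *: y) p) sum1; apply: eq_big_seq => d dE.
have := x'0 d dE; rewrite /x'; case: eqP => _; last first.
  by rewrite subr0 scalerMnr => ->; rewrite scaler0.
by move/eqP; rewrite subr_eq0 scalerMnr => /eqP->.
Qed.

Lemma homogeneous_series_sum_scale n (N : int) p (A : kdist n (V -> V))
    (D : seq int) (A_ : int -> kdist n (V -> V)) (c : int -> R) m d v :
  homogeneous_series N p A -> (forall p', homogeneous_series N p' (A_ p')) ->
  A = \sum_(p' <- D) A_ p' -> homogeneous d v ->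
  \sum_(p' <- D) c p' *: A_ p' m v = c p *: A m v.
Proof.
move=> A_hom A__hom AE v_hom.
apply: (homogeneous_sum_scale (s := d - mono_deg N m)) => [p'||].
- by rewrite addrAC -addrA; apply: (A__hom p' m).2.
- by rewrite addrAC -addrA; apply: (A_hom m).2.
- by rewrite AE !fct_sumE.
Qed.

(** Makes the bracket computable whatever decompositions witness it. Each of its
    two terms sums the pieces of [A] and [B], scaled by signs that depend on
    their degrees and applied to a homogeneous vector, so
    [homogeneous_series_sum_scale] applies once for [A] and once for [B]. *)
Lemma is_bracket_homogE n (N : int) p q (A B : kdist n (V -> V))
    (C : kdist2 n (V -> V)) :
  homogeneous_series N p A -> homogeneous_series N q B -> is_bracket N A B C ->
  forall m l d v, homogeneous d v -> C m l v = homog_bracket N p q A B m l v.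
Proof.
move=> A_hom B_hom [D [E [A_ [B_ [[A__hom AE] [B__hom BE] ->]]]]] m l d v v_hom.
rewrite !fct_sumE (eq_bigr (fun p' =>
    \sum_(q' <- E) mul_zw N p' (A_ p') (B_ q') m l v
  - \sum_(q' <- E) ksign R p' q' *: mul_wz N q' (B_ q') (A_ p') m l v));
  last first.
  by move=> p' _; rewrite !fct_sumE -sumrB.
rewrite sumrB; congr (_ - _).
  rewrite exchange_big /= /mul_zw (eq_bigr (fun q' =>
      ksign R (p - mono_deg N m) (mono_deg N l) *: A m (B_ q' l v))) => [|q' _].
    rewrite -scaler_sumr -linear_fun_sum; last exact: (A_hom m).1.
    by rewrite BE !fct_sumE.
  apply: (homogeneous_series_sum_scale
    (fun p' => ksign R (p' - mono_deg N m) (mono_deg N l)) m A_hom A__hom AE).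
  exact: ((B__hom q' l).2 _ _ v_hom).
pose c p' q' := ksign R p' q' * (ksign R (mono_deg N l) (mono_deg N m)
  * ksign R (q' - mono_deg N l) (mono_deg N m)).
rewrite (eq_bigr (fun p' => B l (c p' q *: A_ p' m v))) => [|p' _].
  rewrite -linear_fun_sum; last exact: (B_hom l).1.
  rewrite (homogeneous_series_sum_scale (c^~ q) m A_hom A__hom AE v_hom).
  by rewrite (linear_funZ (B_hom l).1) -scalerA.
rewrite linear_funZ; last exact: (B_hom l).1.
rewrite -(homogeneous_series_sum_scale (c p') l B_hom B__hom BE
            ((A__hom p' m).2 _ _ v_hom)).
by apply: eq_bigr => q' _; rewrite /mul_wz /= scalerA.
Qed.

End Graded.

(** * Goddard uniqueness *)

Theorem proposition3p2p5 (R : comPzRingType) (n : nat) (N : int)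
    (n_ge1 : (1 <= n)%N) (V : CVA n N R)
    (A : kdist n (V -> V)) (p : int)
    (A_field : is_field A) (A_homog : homogeneous_series N p A)
    (A_local : forall b : V, mutually_local N A (cva_Y V b))
    (a : V) (q : int) (a_homog : homogeneous q a)
    (A_vac : forall m : mono n, A m (cva_vac V) = cva_Y V a m (cva_vac V)) :
  A = cva_Y V a.
Proof.
have vac_hom := cva_vac_degree V.
(* [A] and [Y(a, z)] need a common degree for their brackets with [Y(b, w)]
   to carry the same signs. *)
have a_hom : homogeneous p a.
  have := (A_homog (inl 0%MM)).2 _ _ vac_hom.
  by rewrite A_vac cva_creation cva_T0 subr0 add0r.
have Y_hom := cva_Y_degree a_hom.
have eq_hom d (b : V) m : homogeneous d b -> A m b = cva_Y V a m b.
  move=> b_hom; have Yb_hom := cva_Y_degree b_hom.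
  have [C1 brC1 locC1] := A_local b.
  have [C2 brC2 locC2] := cva_locality a_hom b_hom.
  have C1E m' l := is_bracket_homogE A_homog Yb_hom brC1 m' l vac_hom.
  have C2E m' l := is_bracket_homogE Y_hom Yb_hom brC2 m' l vac_hom.
  have Yb_vac : cva_Y V b (inl 0%MM) (cva_vac V) = b.
    by rewrite cva_creation cva_T0.
  have brE (X : kdist n (V -> V)) m' l :
      homog_bracket N p d X (cva_Y V b) m' l (cva_vac V)
    = ksign R (p - mono_deg N m') (mono_deg N l)
        *: X m' (cva_Y V b l (cva_vac V))
      - ksign R p d *: mul_wz N d (cva_Y V b) X m' l (cva_vac V) by [].
  (* The hypothesis on the vacuum enters here: the two brackets share their
     second term there. *)
  have wzE m' l : mul_wz N d (cva_Y V b) A m' l (cva_vac V)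
                = mul_wz N d (cva_Y V b) (cva_Y V a) m' l (cva_vac V).
    by rewrite /mul_wz !scalrfctE /= A_vac.
  have := local_eq_vector locC1 locC2 (v := cva_vac V) _ m.
  rewrite C1E C2E !brE wzE Yb_vac /ksign mulr0 !scale1r => eqAY.
  apply: (addIr _ (eqAY _)) => m' s.
  (* There is no [Omega_w] in [Y(b, w)] applied to the vacuum. *)
  rewrite C1E C2E !brE wzE !cva_creation; congr (_ *: _ - _).
  by rewrite !linear_fun0 //; [apply: cva_Y_linear | exact: (A_homog _).1].
apply/funext => m; apply/funext => v.
have [D [x [x_hom ->]]] := homogeneous_span v.
rewrite !linear_fun_sum; [|exact: cva_Y_linear|exact: (A_homog m).1].
by apply: eq_bigr => d _; apply: eq_hom (x_hom d).
Qed.
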